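(* Consider the target factor model with Assumptions (A1)–(A4), (A6)(1) and (A7) of the context, suppose $\alpha_s>1/2$ and $r_0\ge1$. Let $\hat{\boldsymbol\Sigma}^{(0)}=\mathbf X^{(0)\top}\mathbf X^{(0)}/T_0$ and $\hat r_0=\arg\max_{1\le r\le r_{\max}}\lambda_r(\hat{\boldsymbol\Sigma}^{(0)})/\lambda_{r+1}(\hat{\boldsymbol\Sigma}^{(0)})$. Then for any $r_{\max}\in\big(r_0,\lfloor c(N\wedge T_0)\rfloor-r_0-1\big]$ (with $c$ from (A7)), $P(\hat r_0=r_0)\to1$ as $\min\{N,T_0\}\to\infty$.
   Context: Model. $N$ is the cross-sectional dimension. Target $\mathbf X^{(0)}=\mathbf F^{(0)}\boldsymbol\Lambda^{(0)\top}+\mathbf E^{(0)}\in\mathbb R^{T_0\times N}$, $\mathbf F^{(0)}=(\mathbf f^{(0)}_1,\dots,\mathbf f^{(0)}_{T_0})^\top\in\mathbb R^{T_0\times r_0}$, $\boldsymbol\Lambda^{(0)}\in\mathbb R^{N\times r_0}$, errors with entries $\epsilon^{(0)}_{ti}$; of the $r_0$ factors, $r_0-s$ are strong and $s$ weak. Source panels $\mathbf X^{(k)}=\mathbf F^{(k)}\boldsymbol\Lambda^{(k)\top}+\mathbf E^{(k)}\in\mathbb R^{T_k\times N}$, $k\in[K]$, with $r_k$ factors. $\lambda_j(\cdot)$ is the $j$-th largest eigenvalue, $\|\cdot\|$ spectral norm, $\|\cdot\|_{\max}$ max entry, $M$ finite constant, $a\wedge b=\min$, $a\vee b=\max$. Assumptions.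 (A1) For all $k\in\{0\}\cup[K]$: $E\|\mathbf f^{(k)}_t\|^4\le M$; $\mathbf F^{(k)\top}\mathbf F^{(k)}/T_k\to\boldsymbol\Sigma^{(k)}_F$ in probability as $T_k\to\infty$, positive definite with bounded distinct eigenvalues. (A2) $\|\boldsymbol\Lambda^{(k)}\|_{\max}\le M$; $\|\mathbf D^{-1/2}\boldsymbol\Lambda^{(0)\top}\boldsymbol\Lambda^{(0)}\mathbf D^{-1/2}-\mathbf I_{r_0}\|\to0$ where $\mathbf D=\mathrm{diag}(\mathbf D_s,\mathbf D_w)$ is diagonal, $(\mathbf D_s)_{ii}\asymp N$ ($i\in[r_0-s]$), $(\mathbf D_w)_{ii}\asymp N^{\alpha_i}$ ($i\in[s]$), $0<\alpha_s\le\dots\le\alpha_1<1$; $\|N^{-1}\boldsymbol\Lambda^{(k)\top}\boldsymbol\Lambda^{(k)}-\mathbf I_{r_k}\|\to0$, $k\in[K]$. (A3) $\|\mathbf E^{(k)}\|^2=O_p(N\vee T_k)$. (A4) For each $t$: $E\|\mathbf D^{-1/2}\sum_i\boldsymbol\Lambda^{(0)\top}_{i,\cdot}\epsilon^{(0)}_{ti}\|^2\le M$ and $E\|N^{-1/2}\sum_i\boldsymbol\Lambda^{(k)\top}_{i,\cdot}\epsilon^{(k)}_{ti}\|^2\le M$ ($k\in[K]$); for each $i$: $E\|T_k^{-1/2}\sum_t\mathbf f^{(k)}_t\epsilon^{(k)}_{ti}\|^2\le M$. (A6)(1) $N/(\sqrt{T_0}N^{\alpha_s})\to0$. (A7) For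 some finite constant $C>0$ and some $c\in(0,1]$, $\lambda_{\lfloor c(N\wedge T_0)\rfloor}\big(\mathbf E^{(0)\top}\mathbf E^{(0)}/(N\vee T_0)\big)\ge C+o_p(1)$. *)

(* Defs.v *)
From HB Require Import structures.
From mathcomp Require Import all_boot all_order all_algebra.
From mathcomp Require Import all_classical all_reals all_analysis.
Set Implicit Arguments. Unset Strict Implicit. Unset Printing Implicit Defensive.
Import Order.TTheory GRing.Theory Num.Theory.
Local Open Scope ring_scope.

Section LinAlg.
Variable R : realType.

Definition is_eigen_seq (n : nat) (A : 'M[R]_n) (s : seq R) : Prop :=
  [/\ size s = n, sorted (fun x y : R => y <= x) s
    & char_poly A = \prod_(x <- s) ('X - x%:P)].

Definition eig_seq (n : nat) (A : 'M[R]_n) : seq R :=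
  match pselect (exists s, is_eigen_seq A s) with
  | left e => sval (cid e)
  | right _ => [::]
  end.

Definition eigval (n : nat) (A : 'M[R]_n) (j : nat) : R := nth 0 (eig_seq A) j.-1.

Definition specnorm (m n : nat) (A : 'M[R]_(m, n)) : R :=
  Num.sqrt (eigval (A^T *m A) 1).

Definition maxnorm (m n : nat) (A : 'M[R]_(m, n)) : R :=
  \big[Num.max/0]_(i < m) \big[Num.max/0]_(j < n) `|A i j|.

Definition vnorm2 (n : nat) (v : 'rV[R]_n) : R := \sum_(i < n) v 0 i ^+ 2.

(** lambda_r(A) / lambda_{r+1}(A) (with the convention x/0 = 0) *)
Definition eig_ratio (n : nat) (A : 'M[R]_n) (r : nat) : R :=
  eigval A r / eigval A r.+1.

(** argmax_{1 <= r <= rmax} lambda_r(A)/lambda_{r+1}(A), ties broken by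
    the smallest index. *)
Definition argmax_ratio (n : nat) (A : 'M[R]_n) (rmax : nat) : nat :=
  foldl (fun best r => if eig_ratio A best < eig_ratio A r then r else best)
        1%N (iota 2 rmax.-1).

Definition Dmhalf (r : nat) (dd : 'I_r -> R) : 'M[R]_r :=
  diag_mx (\row_i (Num.sqrt (dd i))^-1).

End LinAlg.

Local Open Scope classical_set_scope.
Section Prob.
Context (R : realType) (d : measure_display) (Omega : measurableType d).
Variable P : probability Omega R.

Definition inner_prob_ge (A : set Omega) (p : R) : Prop :=
  exists2 B : set Omega, measurable B & (B `<=` A /\ (p%:E <= P B)%E).

(** P(Q n) -> 1 as n -> oo (via inner probability, so no measurability
    of Q n is presupposed) *)
Definition wp_one (Q : nat -> set Omega) : Prop :=
  forall delta : R, 0 < delta -> \forall n \near \oo, inner_prob_ge (Q n) (1 - delta).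

Definition cvg_prob (Y : nat -> Omega -> R) (y : R) : Prop :=
  forall eps : R, 0 < eps -> wp_one (fun n => [set w | `|Y n w - y| <= eps]).

Definition bigOp (Y : nat -> Omega -> R) (a : nat -> R) : Prop :=
  forall delta : R, 0 < delta -> exists K : R, 0 < K /\
    \forall n \near \oo, inner_prob_ge [set w | `|Y n w| <= K * a n] (1 - delta).

End Prob.

(* Main.v *)
Require Import Defs.
From HB Require Import structures.
From mathcomp Require Import all_boot all_order all_algebra.
From mathcomp Require Import all_classical all_reals all_analysis.
From mathcomp Require Import perm ring lra zify.
From mathcomp Require complex.
Import Order.TTheory GRing.Theory Num.Theory.
Import numFieldNormedType.Exports.
Local Open Scope ring_scope.
Local Open Scope classical_set_scope.
Set Implicit Arguments. Unset Strict Implicit. Unset Printing Implicit Defensive.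

(** The proof only needs Weyl-type inequalities. On the kernel of Lam the sample covariance is
    that of E alone, so that lambda_(r0+1) <= |E|^2 / T0, while lambda_(r+1) is at least
    lambda_(r+1+r0) (E^T E) / T0; by (A3) and (A7) both are of the order of
    l = (N \/ T0) / T0, and all ratios beyond r0 are bounded. On the row space of Lam^T,
    of dimension r0, the signal dominates: lambda_r0 is at least of the order a = N^alpha_s. As
    lambda_1 = O(N), ratios before r0 are O(N / a), whereas the ratio at r0 is at least of the
    order a / l. The claim follows from N l / a^2 -> 0, which is (A6)(1) squared when N > T0
    and alpha_s > 1/2 when N <= T0. *)

(** * Quadratic forms *)

Section QuadraticForms.
Variable R : realType.

Definition dot (n : nat) (u v : 'rV[R]_n) : R := (u *m v^T) 0 0.
Definition quad n (A : 'M[R]_n) (v : 'rV[R]_n) : R := dot (v *m A) v.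

Lemma dotE n (u v : 'rV[R]_n) : dot u v = \sum_i u 0 i * v 0 i.
Proof. by rewrite /dot mxE; apply: eq_bigr => i _; rewrite mxE. Qed.

Lemma vnorm2E n (v : 'rV[R]_n) : vnorm2 v = dot v v.
Proof. by rewrite dotE; apply: eq_bigr => i _; rewrite expr2. Qed.

Lemma dot_mulmx m n (u : 'rV[R]_m) (A : 'M[R]_(m, n)) v :
  dot (u *m A) v = dot u (v *m A^T).
Proof. by rewrite /dot trmx_mul trmxK mulmxA. Qed.

Lemma dotC n (u v : 'rV[R]_n) : dot u v = dot v u.
Proof. by rewrite !dotE; apply: eq_bigr => i _; rewrite mulrC. Qed.

Lemma dotDl n (u v w : 'rV[R]_n) : dot (u + v) w = dot u w + dot v w.
Proof. by rewrite /dot mulmxDl mxE. Qed.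

Lemma dotZl n a (u w : 'rV[R]_n) : dot (a *: u) w = a * dot u w.
Proof. by rewrite /dot -scalemxAl mxE. Qed.

Lemma dotDr n (u v w : 'rV[R]_n) : dot u (v + w) = dot u v + dot u w.
Proof. by rewrite !(dotC u) dotDl. Qed.

Lemma dotZr n a (u w : 'rV[R]_n) : dot u (a *: w) = a * dot u w.
Proof. by rewrite !(dotC u) dotZl. Qed.

Lemma vnorm2_ge0 n (v : 'rV[R]_n) : 0 <= vnorm2 v.
Proof. by apply: sumr_ge0 => i _; apply: sqr_ge0. Qed.

Lemma vnorm2_eq0 n (v : 'rV[R]_n) : (vnorm2 v == 0) = (v == 0).
Proof.
apply/eqP/eqP => [v0|->]; last by apply: big1 => i _; rewrite mxE expr0n.
apply/rowP => i; rewrite mxE; apply/eqP; rewrite -sqrf_eq0; apply/eqP.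
move: v0 => /eqP; rewrite psumr_eq0; last by move=> j _; apply: sqr_ge0.
by move=> /allP /(_ i (mem_index_enum _)) /eqP.
Qed.

Lemma vnorm2_gt0 n (v : 'rV[R]_n) : (0 < vnorm2 v) = (v != 0).
Proof. by rewrite lt0r vnorm2_eq0 vnorm2_ge0 andbT. Qed.

Lemma vnorm2D n (u v : 'rV[R]_n) :
  vnorm2 (u + v) = vnorm2 u + 2 * dot u v + vnorm2 v.
Proof. by rewrite !vnorm2E dotDl !dotDr (dotC v u); ring. Qed.

Lemma vnorm2Z n a (u : 'rV[R]_n) : vnorm2 (a *: u) = a ^+ 2 * vnorm2 u.
Proof. by rewrite !vnorm2E dotZl dotZr; ring. Qed.

Lemma dot_CauchySchwarz n (u v : 'rV[R]_n) :
  dot u v ^+ 2 <= vnorm2 u * vnorm2 v.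
Proof.
have [->|v0] := eqVneq v 0.
  by rewrite /dot trmx0 mulmx0 mxE expr0n /= mulr_ge0 // vnorm2_ge0.
have vp : 0 < vnorm2 v by rewrite vnorm2_gt0.
(* The squared norm of |v|^2 u - (u.v) v expands to |v|^2 (|u|^2 |v|^2 - (u.v)^2). *)
have := vnorm2_ge0 (vnorm2 v *: u + (- dot u v) *: v).
rewrite vnorm2D !vnorm2Z dotZl dotZr => h.
rewrite -subr_ge0 -(pmulr_rge0 _ vp).
apply: le_trans h _; rewrite le_eqVlt; apply/orP; left; apply/eqP; ring.
Qed.

Lemma vnorm2D_le n (u v : 'rV[R]_n) :
  vnorm2 (u + v) <= 2 * vnorm2 u + 2 * vnorm2 v.
Proof.
have := vnorm2_ge0 (u + (-1) *: v).
by rewrite !vnorm2D vnorm2Z dotZr; lra.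
Qed.

(** Apply the upper bound to u = (u + v) - v. This splits signal from noise without any control of
    the cross term. *)
Lemma vnorm2D_ge n (u v : 'rV[R]_n) :
  vnorm2 u / 2 - vnorm2 v <= vnorm2 (u + v).
Proof.
have := vnorm2D_le (u + v) (- v); rewrite addrK.
by rewrite -scaleN1r vnorm2Z; lra.
Qed.

Lemma quadB n (A B : 'M[R]_n) v : quad (A - B) v = quad A v - quad B v.
Proof. by rewrite /quad mulmxDr mulmxN dotDl -scaleN1r dotZl; lra. Qed.

Lemma quadZ n a (A : 'M[R]_n) v : quad (a *: A) v = a * quad A v.
Proof. by rewrite /quad -scalemxAr dotZl. Qed.

Lemma quad_conj m n (B : 'M[R]_(m, n)) (A : 'M[R]_n) v :
  quad (B *m A *m B^T) v = quad A (v *m B).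
Proof. by rewrite /quad !mulmxA dot_mulmx trmxK. Qed.

Lemma quad_gram m n (B : 'M[R]_(m, n)) v :
  quad (B^T *m B) v = vnorm2 (v *m B^T).
Proof. by rewrite /quad vnorm2E mulmxA dot_mulmx. Qed.

Lemma quad1 n (v : 'rV[R]_n) : quad 1%:M v = vnorm2 v.
Proof. by rewrite /quad mulmx1 vnorm2E. Qed.

End QuadraticForms.

(** * Spectral theorem for real symmetric matrices *)

Section RealSpectral.
Variable R : realType.
Import complex.

(** Over the complex numbers an eigenvector x + iy exists. Symmetry forces its eigenvalue a to be
    real, so that x and y both satisfy the eigenvector equation over the reals, and one of them is
    nonzero. *)
Lemma sym_real_eigenvector n (A : 'M[R]_n.+1) : A^T = A ->
  exists (l : R) (u : 'rV[R]_n.+1), u *m A = l *: u /\ vnorm2 u = 1.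
Proof.
move=> Asym.
suff [l [u [uA u0]]] : exists (l : R) (u : 'rV[R]_n.+1), u *m A = l *: u /\ u != 0.
  have up : 0 < vnorm2 u by rewrite vnorm2_gt0.
  exists l, ((Num.sqrt (vnorm2 u))^-1 *: u).
  rewrite -scalemxAl uA !scalerA mulrC; split => //.
  by rewrite vnorm2Z exprVn sqr_sqrtr ?ltW// mulVf// gt_eqF.
have [a /eigenvalueP[v vA v0]] :=
  @eigenvalue_closed R[i] n.+1 (map_mx (real_complex R) A) isT.
pose x : 'rV[R]_n.+1 := \row_j complex.Re (v 0 j).
pose y : 'rV[R]_n.+1 := \row_j complex.Im (v 0 j).
have vAE j : \sum_k v 0 k * (real_complex R) (A k j) = a * v 0 j.
  move/rowP: vA => /(_ j); rewrite !mxE => <-.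
  by apply: eq_bigr => k _; rewrite mxE.
have ReM (z : R[i]) b : complex.Re (z * real_complex R b) = complex.Re z * b.
  by case: z => p q /=; rewrite mulr0 subr0.
have ImM (z : R[i]) b : complex.Im (z * real_complex R b) = complex.Im z * b.
  by case: z => p q /=; rewrite mulr0 add0r.
have xA : x *m A = complex.Re a *: x - complex.Im a *: y.
  apply/rowP => j; rewrite !mxE.
  have /(congr1 (@complex.Re R)) := vAE j; rewrite raddf_sum.
  have -> : complex.Re (a * v 0 j) = complex.Re a * complex.Re (v 0 j)
      - complex.Im a * complex.Im (v 0 j) by case: a {vA vAE} => ? ?; case: (v 0 j).
  by move=> <-; apply: eq_bigr => k _; rewrite mxE -ReM.
have yA : y *m A = complex.Re a *: y + complex.Im a *: x.
  apply/rowP => j; rewrite !mxE.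
  have /(congr1 (@complex.Im R)) := vAE j; rewrite raddf_sum.
  have -> : complex.Im (a * v 0 j) = complex.Re a * complex.Im (v 0 j)
      + complex.Im a * complex.Re (v 0 j) by case: a {vA vAE xA} => ? ?; case: (v 0 j).
  by move=> <-; apply: eq_bigr => k _; rewrite mxE -ImM.
have xy0 : ~~ ((x == 0) && (y == 0)).
  apply: contra v0 => /andP[/eqP x0 /eqP y0]; apply/eqP/rowP => j.
  move/rowP: x0 => /(_ j); move/rowP: y0 => /(_ j); rewrite !mxE.
  by case: (v 0 j) => p q /= -> ->.
(* Inserting [xA] and [yA] into this identity, the terms with Re a cancel and Im a (|x|^2 + |y|^2) =
   0 remains. *)
have : dot (x *m A) y = dot (y *m A) x by rewrite dot_mulmx Asym dotC.
rewrite xA yA -scaleNr !dotDl !dotZl -!vnorm2E (dotC y x) => im0.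
have xyp : 0 < vnorm2 x + vnorm2 y.
  move: xy0; rewrite negb_and -!vnorm2_gt0.
  have hx := vnorm2_ge0 x; have hy := vnorm2_ge0 y; case/orP; lra.
have a0 : complex.Im a = 0.
  have : complex.Im a * (vnorm2 x + vnorm2 y) = 0 by lra.
  by move/eqP; rewrite mulf_eq0 (gt_eqF xyp) orbF => /eqP.
move: xA yA; rewrite a0 !scale0r subr0 addr0 => xA yA.
exists (complex.Re a); move: xy0; rewrite negb_and => /orP[x0|y0].
  by exists x.
by exists y.
Qed.

(* H is the Householder reflection exchanging e_0 and u. *)
Lemma unit_row_completion n (u : 'rV[R]_n.+1) : vnorm2 u = 1 ->
  exists H : 'M[R]_n.+1, H *m H^T = 1%:M /\ delta_mx 0 0 *m H = u.
Proof.
move=> u1; pose e : 'rV[R]_n.+1 := delta_mx 0 0.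
have [w wE] : exists w, w = u - e by exists (u - e).
have [/eqP w0|w0] := eqVneq w 0.
  exists 1%:M; rewrite trmx1 !mulmx1; split => //.
  by move: w0; rewrite wE subr_eq0 => /eqP ->.
have c0 : vnorm2 w != 0 by rewrite vnorm2_eq0.
have ee : dot e e = 1.
  by rewrite /dot /e trmx_delta mul_delta_mx mxE !eqxx.
have ww : w *m w^T = (vnorm2 w)%:M.
  by apply/matrixP => i j; rewrite !ord1 vnorm2E /dot !mxE eqxx mulr1n.
have ew : e *m w^T = (dot e w)%:M.
  by apply/matrixP => i j; rewrite !ord1 /dot !mxE eqxx mulr1n.
(* Since |u| = |e| = 1, the reflection along w = u - e sends e to e + w = u. *)
have we : vnorm2 w = - 2 * dot e w.
  rewrite vnorm2E wE -scaleN1r !dotDl !dotDr !dotZl !dotZr (dotC u e) ee.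
  by rewrite -vnorm2E u1; ring.
exists (1%:M - (2 / vnorm2 w) *: (w^T *m w)).
have Ht : (1%:M - (2 / vnorm2 w) *: (w^T *m w))^T =
  1%:M - (2 / vnorm2 w) *: (w^T *m w).
  by rewrite linearB /= linearZ /= trmx1 trmx_mul trmxK.
split.
  have SS : (w^T *m w) *m (w^T *m w) = vnorm2 w *: (w^T *m w).
    by rewrite mulmxA -(mulmxA w^T w w^T) ww mul_mx_scalar -scalemxAl.
  rewrite Ht mulmxBl mul1mx mulmxBr. rewrite mulmx1 -scalemxAl -scalemxAr SS !scalerA.
  have -> : 2 / vnorm2 w * (2 / vnorm2 w) * vnorm2 w = 2 / vnorm2 w + 2 / vnorm2 w.
    by field.
  by rewrite scalerDl opprB addrK subrK.
rewrite -/e mulmxBr mulmx1 -scalemxAr mulmxA ew mul_scalar_mx scalerA.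
have -> : 2 / vnorm2 w * dot e w = -1.
  by apply: (mulIf c0); rewrite mulrAC divfK// mulN1r we; ring.
by rewrite scaleN1r opprK wE addrC subrK.
Qed.

(** Induction on the dimension. In an orthonormal basis that starts with a unit eigenvector, the
    first row of A is a multiple of e_0; by symmetry so is the first column, and the remaining block
    is again symmetric. *)
Lemma sym_spectral n (A : 'M[R]_n) : A^T = A ->
  exists (Q : 'M[R]_n) (d : 'rV[R]_n),
    Q *m Q^T = 1%:M /\ A = Q^T *m diag_mx d *m Q.
Proof.
elim: n A => [|n IHn] A Asym.
  by exists 1%:M, 0; split; apply/matrixP => -[].
have [l [u [uA u1]]] := sym_real_eigenvector Asym.
have [H [HH eH]] := unit_row_completion u1.
have HH' : H^T *m H = 1%:M by apply: mulmx1C.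
have [B BE] : exists B : 'M[R]_(1 + n), B = H *m A *m H^T by exists (H *m A *m H^T).
have Bsym : B^T = B by rewrite BE !trmx_mul trmxK Asym mulmxA.
have eB : delta_mx 0 0 *m B = l *: (delta_mx 0 0 : 'rV_n.+1).
  rewrite BE !mulmxA eH uA -scalemxAl; congr (_ *: _).
  by rewrite -eH -mulmxA HH mulmx1.
have B0 j : B (lshift n 0) j = l * (j == lshift n 0)%:R.
  move/rowP: eB => /(_ j); rewrite -rowE !mxE /= lshift0 => <-.
  by congr (B _ _); apply/val_inj.
have dsym : (drsubmx B)^T = drsubmx B by rewrite trmx_drsub Bsym.
have [Q [d [QQ BQ]]] := IHn _ dsym.
have Bblock : B = block_mx l%:M 0 0 (drsubmx B).
  rewrite -[LHS]submxK; congr block_mx; apply/matrixP => i j; rewrite !mxE.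
  - by rewrite !ord1 B0 eqxx mulr1.
  - by rewrite !ord1 B0 eq_rlshift mulr0.
  - by rewrite !ord1 -Bsym mxE B0 eq_rlshift mulr0.
pose Q1 : 'M[R]_(1 + n) := block_mx 1%:M 0 0 Q.
have Q1Q1 : Q1 *m Q1^T = 1%:M.
  rewrite /Q1 tr_block_mx mulmx_block.
  rewrite !(trmx0, trmx1, mulmx0, mul0mx, mulmx1, addr0, add0r) QQ.
  by rewrite -scalar_mx_block.
have Q1B : Q1^T *m diag_mx (row_mx l%:M d) *m Q1 = B.
  rewrite Bblock BQ /Q1 tr_block_mx diag_mx_row !mulmx_block.
  rewrite !(trmx0, trmx1, mulmx0, mul0mx, mulmx1, mul1mx, addr0, add0r).
  congr block_mx; apply/matrixP => i j; rewrite !ord1 !mxE !eqxx //.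
exists (Q1 *m H), (row_mx l%:M d); split.
  by rewrite trmx_mul mulmxA -(mulmxA Q1) HH mulmx1; exact: Q1Q1.
have -> : A = H^T *m B *m H.
  by rewrite BE !mulmxA HH' mul1mx -mulmxA HH' mulmx1.
by rewrite -Q1B trmx_mul !mulmxA.
Qed.

Lemma char_poly_conj n (Q D : 'M[R]_n) : Q *m Q^T = 1%:M ->
  char_poly (Q^T *m D *m Q) = char_poly D.
Proof.
move=> QQ; have QQ' : Q^T *m Q = 1%:M by apply: mulmx1C.
have QP : map_mx polyC Q^T *m map_mx polyC Q = 1%:M.
  by rewrite -map_mxM QQ' map_mx1.
rewrite /char_poly.
have -> : char_poly_mx (Q^T *m D *m Q) =
   map_mx polyC Q^T *m char_poly_mx D *m map_mx polyC Q.
  rewrite /char_poly_mx mulmxBr mulmxBl -!map_mxM; congr (_ - _).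
  by rewrite mul_mx_scalar -scalemxAl QP scalemx1.
rewrite !det_mulmx mulrAC -det_mulmx QP det1 mul1r //.
Qed.

(** [eig_seq] is a chosen sorted list of roots of the characteristic polynomial. By unique
    factorization it is a permutation of the diagonal given by the spectral theorem; permuting the
    rows of Q accordingly puts the eigenvalues in decreasing order. *)
Lemma eig_seq_diag n (A : 'M[R]_n) : A^T = A ->
  is_eigen_seq A (eig_seq A) /\
  exists Q : 'M[R]_n, Q *m Q^T = 1%:M /\
    A = Q^T *m diag_mx (\row_i nth 0 (eig_seq A) i) *m Q.
Proof.
move=> Asym; have [Q [d [QQ AQ]]] := sym_spectral Asym.
pose t := [tuple d 0 i | i < n].
have chA : char_poly A = \prod_(x <- t) ('X - x%:P).
  rewrite AQ char_poly_conj// char_poly_trig ?diag_mx_is_trig//.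
  rewrite big_tuple; apply: eq_bigr => i _.
  by rewrite !mxE eqxx mulr1n tnth_mktuple.
have ex : exists s, is_eigen_seq A s.
  exists (sort (fun x y : R => y <= x) t); split.
  - by rewrite size_sort size_tuple.
  - by apply: sort_sorted => x y; apply: le_total.
  - by rewrite chA; apply: perm_big; rewrite perm_sym perm_sort.
have es : is_eigen_seq A (eig_seq A).
  by rewrite /eig_seq; case: pselect => // e; apply: (svalP (cid e)).
split => //; case: es => sz _ chs.
have /tuple_permP[p ep] : perm_eq (eig_seq A) t.
  by apply: prod_XsubC_eq; rewrite -chs.
have nth_p (i : 'I_n) : nth 0 (eig_seq A) i = d 0 (p i) by rewrite ep -tnth_nth !tnth_mktuple.
exists (row_perm p Q); split; apply/matrixP => i j.
  move/matrixP: QQ => /(_ (p i) (p j)); rewrite !mxE (inj_eq perm_inj) => <-.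
  by apply: eq_bigr => k _; rewrite !mxE.
rewrite {1}AQ !mul_mx_diag !mxE (reindex_perm p).
by apply: eq_bigr => k _; rewrite !mxE nth_p.
Qed.

End RealSpectral.

(** * Eigenvalue inequalities *)

Section Eigenvalues.
Variable R : realType.

Lemma exists_kernel m n (B : 'M[R]_(m, n)) : (\rank B < m)%N ->
  exists2 v : 'rV[R]_m, v != 0 & v *m B = 0.
Proof.
move=> rB; have kB : kermx B != 0 by rewrite -mxrank_eq0 mxrank_ker subn_eq0 -ltnNge.
exists (nz_row (kermx B)); first by rewrite nz_row_eq0.
by apply/sub_kermxP; apply: nz_row_sub.
Qed.

Lemma mxrank_row_mx m n1 n2 (A : 'M[R]_(m, n1)) (B : 'M[R]_(m, n2)) :
  (\rank (row_mx A B) <= \rank A + \rank B)%N.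
Proof.
rewrite -mxrank_tr tr_row_mx -addsmxE -(mxrank_tr A) -(mxrank_tr B).
exact: mxrank_adds_leqif.
Qed.

(** The entries of [v *m Q^T] are the coordinates of v in an orthonormal eigenbasis, the rows of
    Q. *)
Lemma eig_quad n (A : 'M[R]_n) : A^T = A ->
  exists Q : 'M[R]_n, [/\ Q *m Q^T = 1%:M,
    forall v, quad A v = \sum_(i < n) eigval A i.+1 * (v *m Q^T) 0 i ^+ 2,
    forall v, vnorm2 v = \sum_(i < n) (v *m Q^T) 0 i ^+ 2
    & forall i j, (1 <= i <= j)%N -> (j <= n)%N -> eigval A j <= eigval A i].
Proof.
move=> Asym; have [[sz srt _] [Q [QQ AQ]]] := eig_seq_diag Asym.
exists Q; split => // [v|v|i j /andP[i1 ij] jn].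
- set D := diag_mx _ in AQ.
  have -> : quad A v = quad (Q^T *m D *m Q^T^T) v by rewrite trmxK -AQ.
  rewrite quad_conj /quad dotE mul_mx_diag.
  by apply: eq_bigr => i _; rewrite mxE [X in _ * X * _]mxE /eigval /= expr2 mulrAC mulrC.
- rewrite -[RHS]/(vnorm2 (v *m Q^T)) !vnorm2E dot_mulmx trmxK.
  by rewrite -mulmxA (mulmx1C QQ) mulmx1.
- rewrite /eigval.
  apply: (sorted_leq_nth (leT := fun x y : R => y <= x)) => //.
  + by move=> x y z xy yz; apply: le_trans yz xy.
  + by rewrite inE sz; lia.
  + by rewrite inE sz; lia.
  + lia.
Qed.

(** The kernel of B is the span of the eigenvectors numbered k to n. Subspaces are represented as
    kernels, so that ranks count codimensions and intersecting means concatenating matrices. *)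
Lemma eigval_bottom_space n (A : 'M[R]_n) k : A^T = A -> (1 <= k <= n)%N ->
  exists2 B : 'M[R]_n, (\rank B <= k.-1)%N &
    forall v, v *m B = 0 -> quad A v <= eigval A k * vnorm2 v.
Proof.
move=> Asym /andP[k1 kn]; have [Q [_ qE nE mono]] := eig_quad Asym.
exists (Q^T *m pid_mx k.-1).
  by rewrite (leq_trans (mxrankM_maxr _ _))// rank_pid_mx//; lia.
move=> v; rewrite mulmxA => vB; rewrite qE nE mulr_sumr; apply: ler_sum => i _.
have [ik|ki] := ltnP i k.-1.
  have -> : (v *m Q^T) 0 i = 0.
    move/rowP: vB => /(_ i); rewrite [in RHS]mxE => <-.
    rewrite [RHS]mxE (bigD1 i)//= big1 ?addr0; first by rewrite [X in _ * X]mxE eqxx ik mulr1.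
    move=> j ji; rewrite [X in _ * X]mxE; case: eqP => [/val_inj ij|]; last by rewrite mulr0.
    by rewrite ij eqxx in ji.
  by rewrite expr0n !mulr0.
by apply: ler_wpM2r; rewrite ?sqr_ge0// mono//; lia.
Qed.

(** Here the kernel of B is the span of the first k eigenvectors. *)
Lemma eigval_top_space n (A : 'M[R]_n) k : A^T = A -> (1 <= k <= n)%N ->
  exists2 B : 'M[R]_n, (\rank B <= n - k)%N &
    forall v, v *m B = 0 -> eigval A k * vnorm2 v <= quad A v.
Proof.
move=> Asym /andP[k1 kn]; have [Q [_ qE nE mono]] := eig_quad Asym.
have cE i j : (copid_mx k : 'M[R]_n) i j = ((i == j) && (k <= j)%N)%:R.
  rewrite !mxE -val_eqE /=.
  have [->|_] := eqVneq (i : nat) j; last by rewrite subrr.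
  by rewrite /= ltnNge; case: (k <= j)%N; rewrite ?subrr ?subr0.
exists (Q^T *m copid_mx k).
  by rewrite (leq_trans (mxrankM_maxr _ _))// rank_copid_mx.
move=> v; rewrite mulmxA => vB; rewrite qE nE mulr_sumr; apply: ler_sum => i _.
have [ik|ki] := ltnP i k; last first.
  have -> : (v *m Q^T) 0 i = 0.
    move/rowP: vB => /(_ i); rewrite [in RHS]mxE => <-.
    rewrite [RHS]mxE (bigD1 i)//= big1 ?addr0 => [|j ji].
      by rewrite cE eqxx ki mulr1.
    by rewrite cE (negPf ji) mulr0.
  by rewrite expr0n !mulr0.
by apply: ler_wpM2r; rewrite ?sqr_ge0// mono//; lia.
Qed.

(** One half of Courant-Fischer: the kernel of B and the span of the eigenvectors from j on have
    codimensions at most n - j and j - 1, so they share a nonzero vector, at which the two bounds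
    are compared. *)
Lemma eigval_ge n p (A : 'M[R]_n) (B : 'M[R]_(n, p)) t j : A^T = A ->
  (1 <= j)%N -> (j + \rank B <= n)%N ->
  (forall v, v *m B = 0 -> t * vnorm2 v <= quad A v) -> t <= eigval A j.
Proof.
move=> Asym j1 jn tA.
have [|C rC AC] := @eigval_bottom_space _ A j Asym; first by lia.
have [|v v0] := @exists_kernel _ _ (row_mx B C).
  by have := mxrank_row_mx B C; lia.
rewrite mul_mx_row -[X in _ = X]row_mx0 => /eq_row_mx[vB vC].
by have := le_trans (tA v vB) (AC v vC); rewrite ler_pM2r// vnorm2_gt0.
Qed.

(** The dual half: codimensions less than j and at most n - j again leave a common nonzero
    vector. *)
Lemma eigval_le n p (A : 'M[R]_n) (B : 'M[R]_(n, p)) t j : A^T = A ->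
  (\rank B < j <= n)%N ->
  (forall v, v *m B = 0 -> quad A v <= t * vnorm2 v) -> eigval A j <= t.
Proof.
move=> Asym /andP[j1 jn] tA.
have [|C rC AC] := @eigval_top_space _ A j Asym; first by lia.
have [|v v0] := @exists_kernel _ _ (row_mx B C).
  by have := mxrank_row_mx B C; lia.
rewrite mul_mx_row -[X in _ = X]row_mx0 => /eq_row_mx[vB vC].
by have := le_trans (AC v vC) (tA v vB); rewrite ler_pM2r// vnorm2_gt0.
Qed.

Lemma eigval_anti n (A : 'M[R]_n) i j : A^T = A ->
  (1 <= i <= j)%N -> (j <= n)%N -> eigval A j <= eigval A i.
Proof. by move=> Asym; have [Q [_ _ _ mono]] := eig_quad Asym; apply: mono. Qed.

Lemma quad_le_eigval1 n (A : 'M[R]_n) v : A^T = A ->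
  quad A v <= eigval A 1 * vnorm2 v.
Proof.
move=> Asym; have [Q [_ qE nE mono]] := eig_quad Asym.
rewrite qE nE mulr_sumr; apply: ler_sum => i _.
apply: ler_wpM2r; first exact: sqr_ge0.
by apply: mono; have := ltn_ord i; lia.
Qed.

Lemma eigval_quad_ge n (A : 'M[R]_n) v : A^T = A ->
  eigval A n * vnorm2 v <= quad A v.
Proof.
move=> Asym; have [Q [_ qE nE mono]] := eig_quad Asym.
rewrite qE nE mulr_sumr; apply: ler_sum => i _.
apply: ler_wpM2r; first exact: sqr_ge0.
by apply: mono; have := ltn_ord i; lia.
Qed.

Lemma gram_sym m n (A : 'M[R]_(m, n)) : (A^T *m A)^T = A^T *m A.
Proof. by rewrite trmx_mul trmxK. Qed.

Lemma vnorm2_mul_specnorm m n (A : 'M[R]_(m, n)) v :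
  vnorm2 (v *m A^T) <= specnorm A ^+ 2 * vnorm2 v.
Proof.
case: n A v => [|n] A v.
  rewrite [v]thinmx0 mul0mx; apply: le_trans (mulr_ge0 (sqr_ge0 _) (vnorm2_ge0 _)).
  by rewrite le_eqVlt vnorm2_eq0 eqxx.
rewrite -quad_gram sqr_sqrtr; first exact: quad_le_eigval1 (gram_sym _).
(* The square root in [specnorm] squares back because the top eigenvalue of a Gram matrix is
   nonnegative. The zero matrix has the whole space as kernel. *)
apply: (@eigval_ge _ _ _ (0 : 'M[R]_(n.+1, 1)) _ 1 (gram_sym A)) => //.
  by rewrite mxrank0 addn0.
by move=> u _; rewrite mul0r quad_gram vnorm2_ge0.
Qed.

Lemma quad_specnorm n (A : 'M[R]_n) v : A^T = A ->
  `|quad A v| <= specnorm A * vnorm2 v.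
Proof.
move=> Asym; rewrite -ler_sqr ?nnegrE ?mulr_ge0 ?sqrtr_ge0 ?vnorm2_ge0//.
rewrite -normrX ger0_norm ?sqr_ge0// /quad.
apply: le_trans (dot_CauchySchwarz _ _) _.
rewrite -{1}Asym exprMn [vnorm2 v ^+ 2]expr2 mulrA.
by apply: ler_wpM2r; rewrite ?vnorm2_ge0 ?vnorm2_mul_specnorm.
Qed.

(** The bottom space for k = n has codimension at most n - 1, hence contains a nonzero vector whose
    quadratic form is positive. *)
Lemma posdef_eigval_gt0 n (A : 'M[R]_n) : (0 < n)%N -> A^T = A ->
  (forall v : 'rV[R]_n, v != 0 -> 0 < (v *m A *m v^T) 0 0) -> 0 < eigval A n.
Proof.
move=> n0 Asym Apos.
have [|B rB AB] := @eigval_bottom_space _ A n Asym; first by lia.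
have [|v v0 vB] := @exists_kernel _ _ B; first by lia.
by have := lt_le_trans (Apos v v0) (AB v vB); rewrite pmulr_lgt0// vnorm2_gt0.
Qed.

(** Cauchy-Schwarz column by column. This crude bound is enough, as lambda_1 is only needed up to
    the order N. *)
Lemma vnorm2_mul_entries m n (v : 'rV[R]_m) (L : 'M[R]_(m, n)) M :
  maxnorm L <= M -> vnorm2 (v *m L) <= n%:R * m%:R * M ^+ 2 * vnorm2 v.
Proof.
move=> LM; have M0 : 0 <= M.
  apply: le_trans LM; rewrite /maxnorm; elim/big_ind: _ => // [x y x0 y0|i _].
    by rewrite le_max x0.
  by elim/big_ind: _ => // x y x0 y0; rewrite le_max x0.
have ent i j : L i j ^+ 2 <= M ^+ 2.
  rewrite -real_normK ?num_real// ler_sqr ?nnegrE//.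
  apply: le_trans LM; rewrite /maxnorm.
  apply: le_trans (le_bigmax _ (fun i => \big[Num.max/0]_(j < n) `|L i j|) i).
  exact: (le_bigmax _ (fun j => `|L i j|)).
have -> : n%:R * m%:R * M ^+ 2 * vnorm2 v = \sum_(j < n) (vnorm2 v * \sum_(i < m) M ^+ 2).
  by rewrite !sumr_const !card_ord -[_ *+ n]mulr_natl -[_ *+ m]mulr_natl; ring.
apply: ler_sum => j _.
have -> : (v *m L) 0 j = dot v (col j L)^T.
  by rewrite dotE mxE; apply: eq_bigr => k _; rewrite !mxE.
apply: le_trans (dot_CauchySchwarz _ _) _; apply: ler_wpM2l; first exact: vnorm2_ge0.
by apply: ler_sum => k _; rewrite !mxE.
Qed.

End Eigenvalues.

(** * Sample covariance of a factor model *)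

Definition sample_cov (R : realType) T N (X : 'M[R]_(T, N)) : 'M[R]_N :=
  T%:R^-1 *: (X^T *m X).

Section FactorModel.
Variables (R : realType) (T N r : nat).
Variables (F : 'M[R]_(T, r)) (L : 'M[R]_(N, r)) (E : 'M[R]_(T, N)).
Local Notation X := (F *m L^T + E).
Local Notation A := (sample_cov X).

Lemma sample_cov_sym : A^T = A.
Proof. by rewrite /sample_cov linearZ /= gram_sym. Qed.

Lemma quad_sample_cov v : quad A v = T%:R^-1 * vnorm2 (v *m L *m F^T + v *m E^T).
Proof.
rewrite /sample_cov quadZ quad_gram; congr (_ * vnorm2 _).
by rewrite linearD /= trmx_mul trmxK mulmxDr mulmxA.
Qed.

Lemma eigval_noise_le j : (r < j <= N)%N -> eigval A j <= T%:R^-1 * specnorm E ^+ 2.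
Proof.
move=> /andP[rj jN]; apply: (eigval_le (B := L)); first exact: sample_cov_sym.
  by rewrite jN andbT (leq_ltn_trans (rank_leq_col _)).
move=> v vL; rewrite quad_sample_cov vL mul0mx add0r -mulrA.
by apply: ler_wpM2l; rewrite ?invr_ge0// vnorm2_mul_specnorm.
Qed.

(** Restricting the top k eigenvectors of E^T E to the kernel of L costs at most r dimensions, which
    leaves k - r >= j. *)
Lemma eigval_noise_ge j k (a b : R) : (1 <= j)%N -> (j + r <= k <= N)%N -> 0 < a ->
  b <= eigval (a^-1 *: (E^T *m E)) k -> T%:R^-1 * (a * b) <= eigval A j.
Proof.
move=> j1 /andP[jk kN] a0 bE.
have Esym : (a^-1 *: (E^T *m E))^T = a^-1 *: (E^T *m E).
  by rewrite linearZ /= gram_sym.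
have [|C rC AC] := eigval_top_space (k := k) Esym; first by lia.
apply: (eigval_ge (B := row_mx L C) sample_cov_sym j1).
  by have := mxrank_row_mx L C; have := rank_leq_col L; lia.
move=> v; rewrite mul_mx_row -[X in _ = X]row_mx0 => /eq_row_mx[vL vC].
rewrite quad_sample_cov vL mul0mx add0r -mulrA.
apply: ler_wpM2l; first by rewrite invr_ge0.
rewrite -mulrA -ler_pdivlMl// -quad_gram -quadZ.
by apply: le_trans (AC v vC); apply: ler_wpM2r; rewrite ?vnorm2_ge0.
Qed.

Lemma eigval_le_signal_noise (B M : R) : (0 < N)%N -> 0 <= B ->
  (forall u : 'rV[R]_r, T%:R^-1 * vnorm2 (u *m F^T) <= B * vnorm2 u) ->
  maxnorm L <= M ->
  eigval A 1 <= 2 * (B * (r%:R * N%:R * M ^+ 2)) + 2 * (T%:R^-1 * specnorm E ^+ 2).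
Proof.
move=> N0 B0 FB LM.
apply: (eigval_le (B := 0 : 'M[R]_(N, 1)) sample_cov_sym); first by rewrite mxrank0.
move=> v _; rewrite quad_sample_cov.
have T0 : 0 <= T%:R^-1 :> R by rewrite invr_ge0.
apply: le_trans (ler_wpM2l T0 (vnorm2D_le _ _)) _.
have h1 := FB (v *m L).
have h2 := ler_wpM2l B0 (vnorm2_mul_entries v LM).
have h3 := ler_wpM2l T0 (vnorm2_mul_specnorm E v).
lra.
Qed.

(* With v = a L^T, Cauchy-Schwarz gives |v|^4 = (a . vL)^2 <= |a|^2 |vL|^2, so that
   the lower bound m on L^T L is also a lower bound for |vL|^2 / |v|^2. *)
Lemma signal_row_space (m : R) (a : 'rV[R]_r) :
  (forall u : 'rV[R]_r, m * vnorm2 u <= vnorm2 (u *m L^T)) ->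
  m * vnorm2 (a *m L^T) <= vnorm2 (a *m L^T *m L).
Proof.
move=> mL; set v := a *m L^T.
have [v0|v0] := eqVneq v 0.
  have z n : vnorm2 (0 : 'rV[R]_n) = 0 by apply/eqP; rewrite vnorm2_eq0.
  by rewrite v0 mul0mx !z mulr0.
have vp : 0 < vnorm2 v by rewrite vnorm2_gt0.
rewrite -(ler_pM2l vp).
have [m0|m0] := leP m 0.
  apply: (@le_trans _ _ 0); last by rewrite mulr_ge0 ?vnorm2_ge0.
  by rewrite mulr_ge0_le0 ?vnorm2_ge0// mulr_le0_ge0 ?vnorm2_ge0.
have vE : vnorm2 v = dot a (v *m L) by rewrite vnorm2E {1}/v dot_mulmx trmxK.
have := dot_CauchySchwarz a (v *m L); rewrite -vE => /(ler_wpM2l (ltW m0)) h.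
have := ler_wpM2r (vnorm2_ge0 (v *m L)) (mL a); rewrite -/v; lra.
Qed.

Lemma eigval_signal_ge (mu m : R) : (0 < r)%N -> 0 <= mu -> 0 < m ->
  (forall u : 'rV[R]_r, mu * vnorm2 u <= T%:R^-1 * vnorm2 (u *m F^T)) ->
  (forall u : 'rV[R]_r, m * vnorm2 u <= vnorm2 (u *m L^T)) ->
  mu * m / 2 - T%:R^-1 * specnorm E ^+ 2 <= eigval A r.
Proof.
move=> r0 mu0 m0 Fmu mL.
(* The lower bound on L makes L^T injective, so its row space has dimension exactly r; that space is
   the kernel of the cokernel matrix, of rank N - r. *)
have /eqP rL : row_free L^T.
  apply: inj_row_free => v vL; apply/eqP; rewrite -vnorm2_eq0 eq_le vnorm2_ge0 andbT.
  rewrite -(pmulr_rle0 _ m0) (le_trans (mL v))// vL.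
  by rewrite le_eqVlt vnorm2_eq0 eqxx.
apply: (eigval_ge (B := cokermx L^T) sample_cov_sym r0).
  by rewrite mxrank_coker rL; have := rank_leq_col L^T; rewrite rL; lia.
move=> v /eqP; rewrite -submxE => /submxP[a va].
rewrite quad_sample_cov.
have T0 : 0 <= T%:R^-1 :> R by rewrite invr_ge0.
apply: le_trans (ler_wpM2l T0 (vnorm2D_ge _ _)).
have h1 := Fmu (v *m L).
have h2 := ler_wpM2l mu0 (signal_row_space a mL).
have h3 := ler_wpM2l T0 (vnorm2_mul_specnorm E v).
rewrite -va in h2; lra.
Qed.

(** Put b = u D^(1/2). The normalized Gram matrix is within 1/2 of the identity, so its form at b,
    which equals |u L^T|^2, is at least |b|^2 / 2, while |b|^2 >= m |u|^2. *)
Lemma loadings_ge (dd : 'I_r -> R) (m : R) : 0 < m -> (forall i, m <= dd i) ->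
  specnorm (Dmhalf dd *m (L^T *m L) *m Dmhalf dd - 1%:M) <= 1 / 2 ->
  forall u : 'rV[R]_r, m / 2 * vnorm2 u <= vnorm2 (u *m L^T).
Proof.
move=> m0 mdd hs u.
have dd0 i : 0 < dd i by apply: lt_le_trans m0 _.
have Dt : (Dmhalf dd)^T = Dmhalf dd by rewrite /Dmhalf tr_diag_mx.
pose b : 'rV[R]_r := \row_i (u 0 i * Num.sqrt (dd i)).
have bu : b *m Dmhalf dd = u.
  rewrite /Dmhalf mul_mx_diag; apply/rowP => i; rewrite !mxE mulfK//.
  by rewrite gt_eqF// sqrtr_gt0.
have bE : m * vnorm2 u <= vnorm2 b.
  rewrite /vnorm2 mulr_sumr; apply: ler_sum => i _.
  rewrite mxE exprMn (sqr_sqrtr (ltW (dd0 i))) mulrC.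
  exact: ler_wpM2l (sqr_ge0 _) _ _ (mdd i).
have Ssym : (Dmhalf dd *m (L^T *m L) *m Dmhalf dd - 1%:M)^T
    = Dmhalf dd *m (L^T *m L) *m Dmhalf dd - 1%:M.
  by rewrite linearB /= trmx1 !trmx_mul !trmxK Dt !mulmxA.
have := quad_specnorm b Ssym; rewrite quadB quad1 -{2}Dt quad_conj bu quad_gram.
rewrite ler_norml => /andP[h _].
have := ler_wpM2r (vnorm2_ge0 b) hs; lra.
Qed.

End FactorModel.

(** Carries the extreme eigenvalues of a limit S over to a nearby G; it serves for F^T F / T and its
    probability limit. *)
Lemma quad_perturb (R : realType) n (G S : 'M[R]_n) (e : R) v : G^T = G -> S^T = S ->
  specnorm (G - S) <= e ->
  (eigval S n - e) * vnorm2 v <= quad G v <= (eigval S 1 + e) * vnorm2 v.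
Proof.
move=> Gs Ss hs.
have := @quad_specnorm _ _ (G - S) v; rewrite linearB /= Gs Ss => /(_ erefl).
rewrite quadB ler_norml => /andP[h1 h2].
have h3 := ler_wpM2r (vnorm2_ge0 v) hs.
have h4 := quad_le_eigval1 v Ss; have h5 := eigval_quad_ge v Ss.
by apply/andP; split; lra.
Qed.

(** * The maximizer of the eigenvalue ratios *)

Lemma argmax_ratio_eq (R : realType) n (A : 'M[R]_n) rmax r0 : (1 <= r0 <= rmax)%N ->
  (forall r, (1 <= r <= rmax)%N -> r != r0 -> eig_ratio A r < eig_ratio A r0) ->
  argmax_ratio A rmax = r0.
Proof.
move=> hr0 hmax; rewrite /argmax_ratio.
have : {in 1%N :: iota 2 rmax.-1, forall r, r != r0 -> eig_ratio A r < eig_ratio A r0}.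
  by move=> r; rewrite inE mem_iota => hr; apply: hmax; lia.
have : r0 \in 1%N :: iota 2 rmax.-1 by rewrite inE mem_iota; lia.
(* Invariant of the fold: r0 is the current best or still to come, and its ratio is strictly above
   that of every other candidate. *)
move: (iota _ _) => l; move: 1%N => b; elim: l b {hmax} => [|x l IHl] b /= r0l hmax.
  by move: r0l; rewrite inE => /eqP.
have hl y : y \in l -> y != r0 -> eig_ratio A y < eig_ratio A r0.
  by move=> yl; apply: hmax; rewrite !inE yl !orbT.
have hb : b != r0 -> eig_ratio A b < eig_ratio A r0 by apply: hmax; rewrite inE eqxx.
have hx : x != r0 -> eig_ratio A x < eig_ratio A r0.
  by apply: hmax; rewrite !inE eqxx orbT.
apply: IHl; last first.
  by move=> y; rewrite inE => /orP[/eqP->|]; [case: ifP | apply: hl].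
move: r0l; rewrite !inE => /or3P[/eqP r0b|/eqP r0x|->]; last by rewrite orbT.
  rewrite -r0b in hb *; have [<-|/hx/ltW] := eqVneq x r0; first by rewrite ltxx eqxx.
  by rewrite ltNge => ->; rewrite eqxx.
rewrite -r0x; have [->|/hb ->] := eqVneq b r0; last by rewrite eqxx.
by rewrite ltxx eqxx.
Qed.

(** Ratios before r0 are at most top / gap, those after r0 at most noise / low, and the one at r0 is
    at least gap / noise; the last two hypotheses compare these quotients. As low > 0, all
    denominators up to index rmax + 1 are positive. *)
Lemma argmax_ratio_gap (R : realType) n (A : 'M[R]_n) (r0 rmax : nat)
    (top gap noise low : R) :
  A^T = A -> (1 <= r0 <= rmax)%N -> (rmax < n)%N ->
  0 < gap -> 0 < low ->
  eigval A 1 <= top -> gap <= eigval A r0 -> eigval A r0.+1 <= noise ->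
  low <= eigval A rmax.+1 ->
  top * noise < gap ^+ 2 -> noise ^+ 2 < gap * low ->
  argmax_ratio A rmax = r0.
Proof.
move=> Asym /andP[r1 rr] rn gap0 fl0 htop hgap hnoise hfl h1 h2.
have anti i j : (1 <= i <= j)%N -> (j <= n)%N -> eigval A j <= eigval A i.
  exact: eigval_anti.
have noise0 : 0 < noise.
  by apply: lt_le_trans hnoise; apply: lt_le_trans fl0 (le_trans hfl (anti _ _ _ _)); lia.
have l0 : 0 < eigval A r0.+1.
  by apply: lt_le_trans fl0 (le_trans hfl (anti _ _ _ _)); lia.
have big : gap / noise <= eig_ratio A r0.
  rewrite /eig_ratio; apply: ler_pM => //; first exact: ltW.
    by rewrite invr_ge0 ltW.
  by rewrite lef_pV2.
apply: argmax_ratio_eq; first by rewrite r1.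
move=> r /andP[rp rle] rne; apply: lt_le_trans big; rewrite /eig_ratio.
have [rlt|rgt] := ltnP r r0.
  have d : gap <= eigval A r.+1 by apply: le_trans hgap (anti _ _ _ _); lia.
  have u : eigval A r <= top by apply: le_trans (anti _ _ _ _) htop; lia.
  have d0 : 0 < eigval A r.+1 by apply: lt_le_trans d.
  rewrite ltr_pdivrMr// mulrAC ltr_pdivlMr//.
  apply: (@le_lt_trans _ _ (top * noise)); first by rewrite ler_wpM2r// ltW.
  by apply: lt_le_trans h1 _; rewrite expr2 ler_pM2l.
have d : low <= eigval A r.+1 by apply: le_trans hfl (anti _ _ _ _); lia.
have u : eigval A r <= noise by apply: le_trans (anti _ _ _ _) hnoise; lia.
have d0 : 0 < eigval A r.+1 by apply: lt_le_trans d.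
rewrite ltr_pdivrMr// mulrAC ltr_pdivlMr//.
apply: (@le_lt_trans _ _ (noise * noise)); first by rewrite ler_wpM2r// ltW.
by rewrite -expr2; apply: lt_le_trans h2 _; rewrite ler_pM2l.
Qed.

(** * Inner probability and asymptotics *)

Section InnerProbability.
Context (R : realType) (d : measure_display) (Omega : measurableType d).
Variable P : probability Omega R.

Lemma inner_prob_geS (A B : set Omega) (p : R) : A `<=` B ->
  inner_prob_ge P A p -> inner_prob_ge P B p.
Proof. by move=> AB [C mC [CA pC]]; exists C => //; split => //; apply: subset_trans AB. Qed.

(** Union bound for the complements of the measurable witnesses. *)
Lemma inner_prob_geI (A B : set Omega) (a b : R) :
  inner_prob_ge P A (1 - a) -> inner_prob_ge P B (1 - b) ->
  inner_prob_ge P (A `&` B) (1 - (a + b)).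
Proof.
move=> [A' mA [AA pA]] [B' mB [BB pB]]; exists (A' `&` B'); first exact: measurableI.
split; first exact: setISS.
have mAB : measurable (A' `&` B') by apply: measurableI.
have : (P (~` (A' `&` B')) <= P (~` A') + P (~` B'))%E.
  by rewrite setCI; apply: measureU2; apply: measurableC.
rewrite !probability_setC//; move: pA pB.
rewrite -(fineK (fin_num_measure P _ mA)) -(fineK (fin_num_measure P _ mB)).
rewrite -(fineK (fin_num_measure P _ mAB)) -!EFinB -EFinD !lee_fin; lra.
Qed.

End InnerProbability.

Section Asymptotics.
Variable R : realType.

(** Since x^(2 alpha) = x x^b with b = 2 alpha - 1 > 0, it suffices that x >= eta^(-1/b). *)
Lemma powR_dominates (alpha eta : R) (x : nat -> R) : 1 / 2 < alpha -> 0 < eta ->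
  (forall K : R, \forall n \near \oo, K <= x n) ->
  \forall n \near \oo, x n <= eta * (x n `^ alpha) ^+ 2.
Proof.
move=> al eta0 xoo; pose b := 2 * alpha - 1.
have b0 : 0 < b by rewrite /b; lra.
near=> n.
have x1 : 1 <= x n by near: n; apply: xoo.
have xp : 0 < x n by lra.
have -> : (x n `^ alpha) ^+ 2 = x n * x n `^ b.
  rewrite -powR_mulrn ?powR_ge0// -powRrM (_ : alpha * 2%:R = 1 + b); last first.
    by rewrite /b; ring.
  by rewrite powRD ?powRr1 ?(ltW xp)// (gt_eqF xp) implybT.
rewrite mulrCA (ler_pMr _ xp) -ler_pdivrMl// mulr1.
have -> : eta^-1 = (eta^-1 `^ b^-1) `^ b.
  by rewrite -powRrM mulVf ?gt_eqF// powRr1// invr_ge0 ltW.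
apply: ge0_ler_powR; rewrite ?nnegrE ?powR_ge0 ?(ltW b0) ?(ltW xp)//.
by near: n; apply: xoo.
Unshelve. all: by end_near. Qed.

Lemma dimension_ratio_small (N T : nat -> nat) (alpha eta : R) : 1 / 2 < alpha -> 0 < eta ->
  (forall K : nat, \forall n \near \oo, (K <= minn (N n) (T n))%N) ->
  (fun n => (N n)%:R / (Num.sqrt (T n)%:R * (N n)%:R `^ alpha)) @ \oo --> (0 : R) ->
  \forall n \near \oo,
    (N n)%:R * ((T n)%:R^-1 * (maxn (N n) (T n))%:R) <= eta * ((N n)%:R `^ alpha) ^+ 2.
Proof.
move=> al eta0 hNT hA6.
have xoo K : \forall n \near \oo, K <= (N n)%:R :> R.
  have := hNT (Num.truncn K).+1; apply: filterS => n hn.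
  apply: le_trans (ltW (truncnS_gt K)) _; by move: hn; rewrite ler_nat leq_min => /andP[].
have se : 0 < Num.sqrt eta by rewrite sqrtr_gt0.
near=> n.
have : (1 <= minn (N n) (T n))%N by near: n; apply: hNT.
rewrite leq_min => /andP[N1 T1].
have Tp : 0 < (T n)%:R :> R by rewrite ltr0n.
have Np : 0 < (N n)%:R :> R by rewrite ltr0n.
have ap : 0 < (N n)%:R `^ alpha by rewrite powR_gt0.
have [NleT|TltN] := leqP (N n) (T n).
  rewrite mulVf ?gt_eqF// mulr1.
  by near: n; apply: powR_dominates.
(* The threshold is sqrt(eta), because squaring turns the left side into N^2 / (T N^(2 alpha)); for
   N > T, N^2 / T is the quantity to bound. *)
have : `|(N n)%:R / (Num.sqrt (T n)%:R * (N n)%:R `^ alpha)| <= Num.sqrt eta.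
  by near: n; apply: cvgr0_norm_le.
have q0 : 0 <= (N n)%:R / (Num.sqrt (T n)%:R * (N n)%:R `^ alpha).
  by rewrite divr_ge0 ?mulr_ge0 ?sqrtr_ge0 ?(ltW Np) ?(ltW ap).
rewrite (ger0_norm q0) => /(lerXn2r 2 q0 (sqrtr_ge0 eta)).
rewrite expr_div_n exprMn (sqr_sqrtr (ltW Tp)) (sqr_sqrtr (ltW eta0)).
rewrite ler_pdivrMr; last by rewrite mulr_gt0 ?exprn_gt0.
rewrite [X in _ -> X <= _]mulrCA ler_pdivrMl// -expr2 => h; apply: le_trans h _.
by rewrite le_eqVlt; apply/orP; left; apply/eqP; ring.
Unshelve. all: by end_near. Qed.

End Asymptotics.

(** * The ratio estimator in the factor model: first for a fixed sample, then in probability *)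

Lemma argmax_ratio_factor (R : realType) (T N r rmax k : nat)
    (F : 'M[R]_(T, r)) (L : 'M[R]_(N, r)) (E : 'M[R]_(T, N)) (mu B M m K C l : R) :
  l = T%:R^-1 * (maxn N T)%:R ->
  (0 < T)%N -> (0 < r <= rmax)%N -> (rmax + r + 1 <= k <= N)%N ->
  0 < mu -> 0 < m -> 0 <= B -> 0 < C ->
  (forall u : 'rV[R]_r,
     mu * vnorm2 u <= T%:R^-1 * vnorm2 (u *m F^T) <= B * vnorm2 u) ->
  maxnorm L <= M ->
  (forall u : 'rV[R]_r, m * vnorm2 u <= vnorm2 (u *m L^T)) ->
  specnorm E ^+ 2 <= K * (maxn N T)%:R ->
  C <= eigval ((maxn N T)%:R^-1 *: (E^T *m E)) k ->
  l <= N%:R -> K * l <= (mu * m / 4) ->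
  (2 * (B * r%:R * M ^+ 2) + 2 * K) * K * (N%:R * l) < (mu * m / 4) ^+ 2 ->
  K ^+ 2 * l < (mu * m / 4) * C ->
  argmax_ratio (sample_cov (F *m L^T + E)) rmax = r.
Proof.
move=> lE T0 /andP[r0 rr] /andP[rk kN].
have [N0 r1N rmN] : [/\ (0 < N)%N, (r < r.+1 <= N)%N & (rmax.+1 + r <= k <= N)%N].
  by split; lia.
have rN : (rmax < N)%N by lia.
move=> mu0 m0 B0 C0 FB LM mL EK EC lN h1 h2 h3.
have Tp : 0 < T%:R :> R by rewrite ltr0n.
have Ti : 0 <= T%:R^-1 :> R by rewrite invr_ge0 ltW.
have NTp : 0 < (maxn N T)%:R :> R by rewrite ltr0n leq_max T0 orbT.
have lp : 0 < l by rewrite lE mulr_gt0 ?invr_gt0.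
have gp : 0 < mu * m / 4 by rewrite divr_gt0 ?mulr_gt0.
have noise : T%:R^-1 * specnorm E ^+ 2 <= K * l.
  by rewrite lE [leRHS]mulrCA; apply: ler_wpM2l.
have K0 : 0 <= K by rewrite -(pmulr_lge0 _ lp) (le_trans _ noise)// mulr_ge0 ?sqr_ge0.
set A := sample_cov _.
have FB' u : T%:R^-1 * vnorm2 (u *m F^T) <= B * vnorm2 u by case/andP: (FB u).
have Fmu u : mu * vnorm2 u <= T%:R^-1 * vnorm2 (u *m F^T) by case/andP: (FB u).
have top : eigval A 1 <=
    2 * (B * (r%:R * N%:R * M ^+ 2)) + 2 * (T%:R^-1 * specnorm E ^+ 2).
  exact: eigval_le_signal_noise N0 B0 FB' LM.
have sig : mu * m / 2 - T%:R^-1 * specnorm E ^+ 2 <= eigval A r.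
  exact: eigval_signal_ge r0 (ltW mu0) m0 Fmu mL.
have nse : eigval A r.+1 <= T%:R^-1 * specnorm E ^+ 2.
  exact: eigval_noise_le.
(* The denominator of the last ratio is lambda_(rmax+1), whence the requirement rmax + 1 + r <=
   k. *)
have low : l * C <= eigval A rmax.+1.
  by rewrite lE -mulrA; apply: (eigval_noise_ge _ _ (k := k)).
have Asym : A^T = A by apply: sample_cov_sym.
move: (T%:R^-1 * specnorm E ^+ 2) noise top sig nse => e noise top sig nse.
clearbody A.
(* The signal bound mu m / 2 loses at most K l <= mu m / 4 to noise, which leaves mu m / 4 as gap.
   In the bound for lambda_1 the noise is absorbed by l <= N. *)
apply: (@argmax_ratio_gap _ _ A _ _
  ((2 * (B * r%:R * M ^+ 2) + 2 * K) * N%:R) (mu * m / 4) (K * l) (l * C)) => //.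
- by rewrite r0.
- exact: mulr_gt0.
- have h4 := ler_wpM2l K0 lN; lra.
- lra.
- exact: le_trans nse noise.
- by apply: le_lt_trans h2; rewrite le_eqVlt; apply/orP; left; apply/eqP; ring.
- have := h3; rewrite -(ltr_pM2r lp) => h; apply: le_lt_trans (lt_le_trans h _).
    by rewrite le_eqVlt; apply/orP; left; apply/eqP; ring.
  by rewrite le_eqVlt; apply/orP; left; apply/eqP; ring.
Qed.

Theorem theorem3
  (R : realType) (d : measure_display) (Omega : measurableType d)
  (P : probability Omega R)
  (N T0 : nat -> nat) (r0 s : nat) (alpha : nat -> R) (M : R)
  (F : forall n, Omega -> 'M[R]_(T0 n, r0))
  (Lam : forall n, 'M[R]_(N n, r0))
  (E : forall n, Omega -> 'M[R]_(T0 n, N n))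
  (dd : nat -> 'I_r0 -> R) (SigF : 'M[R]_r0) (C c : R) (rmax : nat -> nat)
  (* regime: min{N, T0} -> oo *)
  (hNT : forall K : nat, \forall n \near \oo, (K <= minn (N n) (T0 n))%N)
  (* r0 >= 1 factors, of which s >= 1 weak (first r0 - s strong) *)
  (hr0 : (1 <= r0)%N) (hs : (1 <= s <= r0)%N)
  (halpha : [/\ 0 < alpha s, alpha 1 < 1
             & forall i : nat, (1 <= i < s)%N -> alpha i.+1 <= alpha i])
  (halpha_half : 1 / 2 < alpha s)
  (* the factors and errors are random variables *)
  (hFm : forall n (t : 'I_(T0 n)) (k : 'I_r0), measurable_fun setT (fun w => F n w t k))
  (hEm : forall n (t : 'I_(T0 n)) (i : 'I_(N n)), measurable_fun setT (fun w => E n w t i))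
  (* (A1) *)
  (hA1a : forall n (t : 'I_(T0 n)),
      (\int[P]_w ((vnorm2 (row t (F n w))) ^+ 2)%:E <= M%:E)%E)
  (hA1b : cvg_prob P (fun n w => specnorm ((T0 n)%:R^-1 *: ((F n w)^T *m F n w) - SigF)) 0)
  (hA1c : SigF^T = SigF)
  (hA1d : forall v : 'rV[R]_r0, v != 0 -> 0 < (v *m SigF *m v^T) 0 0)
  (hA1e : forall j : nat, (1 <= j < r0)%N -> eigval SigF j.+1 < eigval SigF j)
  (* (A2) *)
  (hA2a : forall n, maxnorm (Lam n) <= M)
  (hA2b : exists c1 c2 : R, [/\ 0 < c1, 0 < c2 &
      \forall n \near \oo, forall i : 'I_r0,
        let a := if (i < r0 - s)%N then 1 else alpha (i - (r0 - s)).+1 in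
        c1 * ((N n)%:R `^ a) <= dd n i /\ dd n i <= c2 * ((N n)%:R `^ a)])
  (hA2c : (fun n => specnorm (Dmhalf (dd n) *m ((Lam n)^T *m Lam n) *m Dmhalf (dd n)
                               - 1%:M)) @ \oo --> (0 : R))
  (* (A3) *)
  (hA3 : bigOp P (fun n w => specnorm (E n w) ^+ 2) (fun n => (maxn (N n) (T0 n))%:R))
  (* (A4) *)
  (hA4a : forall n (t : 'I_(T0 n)),
      (\int[P]_w (vnorm2 (row t (E n w) *m Lam n *m Dmhalf (dd n)))%:E <= M%:E)%E)
  (hA4b : forall n (i : 'I_(N n)),
      (\int[P]_w (vnorm2 ((Num.sqrt (T0 n)%:R)^-1 *: ((col i (E n w))^T *m F n w)))%:E
        <= M%:E)%E)
  (* (A6)(1) *)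
  (hA6 : (fun n => (N n)%:R / (Num.sqrt (T0 n)%:R * (N n)%:R `^ alpha s))
           @ \oo --> (0 : R))
  (* (A7) *)
  (hC : 0 < C) (hc : 0 < c <= 1)
  (hA7 : forall eps : R, 0 < eps -> wp_one P (fun n =>
      [set w | C - eps <= eigval ((maxn (N n) (T0 n))%:R^-1 *: ((E n w)^T *m E n w))
                                 (Num.truncn (c * (minn (N n) (T0 n))%:R))]))
  (* r_max in (r0, floor(c (N /\ T0)) - r0 - 1] *)
  (hrmax : \forall n \near \oo,
      (r0 < rmax n)%N /\ (rmax n <= Num.truncn (c * (minn (N n) (T0 n))%:R) - r0 - 1)%N) :
  wp_one P (fun n => [set w |
    argmax_ratio ((T0 n)%:R^-1 *:
        ((F n w *m (Lam n)^T + E n w)^T *m (F n w *m (Lam n)^T + E n w))) (rmax n) = r0]).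
Proof.
have [_ alpha1 alphaS] := halpha.
have alpha_min i : (1 <= i <= s)%N -> alpha s <= alpha i.
  move=> /andP[i1 /subnKC]; move: (s - i)%N => k; elim: k i i1 => [|k IHk] i i1.
    by rewrite addn0 => ->.
  rewrite addnS -addSn => is'; apply: le_trans (IHk _ _ is') (alphaS _ _) => //; lia.
have alpha_lt1 : alpha s < 1 by apply: le_lt_trans (alpha_min 1%N _) alpha1; lia.
have [c1 [c2 [c10 _ hdd]]] := hA2b.
(* mu is half the smallest eigenvalue of the limit: when F^T F / T0 is within mu of [SigF], its
   eigenvalues stay between mu and B. *)
have [mu mu0 muE] : exists2 mu, 0 < mu & eigval SigF r0 = 2 * mu.
  exists (eigval SigF r0 / 2); last by field.
  by rewrite divr_gt0// posdef_eigval_gt0.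
pose B := eigval SigF 1 + mu.
have B0 : 0 <= B.
  have : eigval SigF r0 <= eigval SigF 1 by apply: eigval_anti.
  by rewrite muE /B; move: mu0; lra.
move=> delta delta0.
(* One third of delta for each of three events: the bound on |E|, the lower bound on the noise
   eigenvalue, and the closeness of F^T F / T0 to its limit. *)
have d3 : 0 < delta / 3 by rewrite divr_gt0.
have [K [K0 hE]] := hA3 _ d3.
have C2 : 0 < C / 2 by rewrite divr_gt0.
have hlow := hA7 _ C2 _ d3.
have hF := hA1b _ mu0 _ d3.
(* With a = N^alpha_s, the loadings give m = c1 a / 2, so the gap mu m / 4 is kappa a. *)
pose kappa := mu * (c1 / 2) / 4.
have kappa0 : 0 < kappa by rewrite divr_gt0// mulr_gt0// divr_gt0.
pose D := 2 * (B * r0%:R * M ^+ 2) + 2 * K.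
have D0 : 0 < D by rewrite ltr_wpDl ?mulr_gt0// mulr_ge0// mulr_ge0 ?sqr_ge0// mulr_ge0.
(* eta bounds both l / a and N l / a^2. Its four upper bounds yield the four final numeric
   hypotheses of [argmax_ratio_factor]; the factors 2 in the witness make the last two strict. *)
have [eta [eta0 eta1 etaK etaD etaC]] : exists eta : R, [/\ 0 < eta, eta <= 1,
    K * eta <= kappa, D * K * eta < kappa ^+ 2 & K ^+ 2 * eta < kappa * (C / 2)].
  exists (Num.min (Num.min 1 (kappa / K))
    (Num.min (kappa ^+ 2 / (2 * (D * K))) (kappa * (C / 2) / (2 * K ^+ 2)))).
  have K20 : 0 < K ^+ 2 by rewrite exprn_gt0.
  have DK0 : 0 < D * K by rewrite mulr_gt0.
  have kap2 : 0 < kappa ^+ 2 by rewrite exprn_gt0.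
  have kC : 0 < kappa * (C / 2) by rewrite mulr_gt0.
  set e := Num.min _ _.
  have [e1 e2 e3 e4] : [/\ e <= 1, e <= kappa / K, e <= kappa ^+ 2 / (2 * (D * K))
      & e <= kappa * (C / 2) / (2 * K ^+ 2)].
    by rewrite /e; split; rewrite !ge_min lexx ?orbT.
  split => //.
  - by rewrite /e !lt_min ltr01 !(divr_gt0, mulr_gt0).
  - by rewrite mulrC -ler_pdivlMr.
  - by move: e3; rewrite ler_pdivlMr ?mulr_gt0//; lra.
  - by move: e4; rewrite ler_pdivlMr ?mulr_gt0//; lra.
have hsmall := dimension_ratio_small halpha_half eta0 hNT hA6.
near=> n.
have : (1 <= minn (N n) (T0 n))%N by near: n; apply: hNT.
rewrite leq_min => /andP[N1 T1].
have Np : 1 <= (N n)%:R :> R by rewrite ler1n.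
have hl : (N n)%:R * ((T0 n)%:R^-1 * (maxn (N n) (T0 n))%:R)
    <= eta * ((N n)%:R `^ alpha s) ^+ 2.
  by near: n; exact: hsmall.
set a := (N n)%:R `^ alpha s in hl *.
have a0 : 0 < a by rewrite powR_gt0// (lt_le_trans _ Np).
have aN : a <= (N n)%:R.
  by rewrite -[leRHS]powRr1 ?(le_trans _ Np)// ler_powR// ltW.
set l := (T0 n)%:R^-1 * (maxn (N n) (T0 n))%:R in hl.
have l0 : 0 <= l by rewrite mulr_ge0 ?invr_ge0.
(* As a <= N, a l <= N l <= eta a^2; dividing by a gives a bound linear in a. *)
have la : l <= eta * a.
  rewrite -(ler_pM2l a0) (_ : a * (eta * a) = eta * a ^+ 2); last by ring.
  by apply: le_trans hl; apply: ler_wpM2r.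
have ddlow i : c1 * a <= dd n i.
  have : forall i : 'I_r0,
    let a := if (i < r0 - s)%N then 1 else alpha (i - (r0 - s)).+1 in
    c1 * ((N n)%:R `^ a) <= dd n i /\ dd n i <= c2 * ((N n)%:R `^ a).
    by near: n; exact: hdd.
  (* Every exponent, 1 for strong factors and alpha_i for weak ones, is at least alpha_s, so the
     weakest factor sets the common lower bound. *)
  move=> /(_ i) /= [ddi _]; apply: le_trans ddi; apply: ler_wpM2l; first exact: ltW.
  apply: ler_powR => //; case: ltnP => [_|ri]; first exact: ltW.
  by apply: alpha_min; have := ltn_ord i; clear -ri hs; lia.
have hLam : specnorm (Dmhalf (dd n) *m ((Lam n)^T *m Lam n) *m Dmhalf (dd n) - 1%:M)
    <= 1 / 2.
  have : `|specnorm (Dmhalf (dd n) *m ((Lam n)^T *m Lam n) *m Dmhalf (dd n) - 1%:M)|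
      <= 1 / 2 by near: n; apply: cvgr0_norm_le.
  by apply: le_trans; apply: ler_norm.
have [r0max maxk] : (r0 < rmax n)%N /\
  (rmax n <= Num.truncn (c * (minn (N n) (T0 n))%:R) - r0 - 1)%N
  by near: n; exact: hrmax.
have kN : (Num.truncn (c * (minn (N n) (T0 n))%:R) <= N n)%N.
  have /andP[/ltW cp c_le1] := hc.
  rewrite -(ler_nat R); apply: (@le_trans _ _ (c * (minn (N n) (T0 n))%:R)).
    by rewrite truncn_le mulr_ge0.
  by apply: (@le_trans _ _ (minn (N n) (T0 n))%:R); rewrite ?ler_piMl// ler_nat geq_minl.
have pF : inner_prob_ge P
    [set w | `|specnorm ((T0 n)%:R^-1 *: ((F n w)^T *m F n w) - SigF) - 0| <= mu]
    (1 - delta / 3).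
  by near: n; exact: hF.
have pE : inner_prob_ge P
    [set w | `|specnorm (E n w) ^+ 2| <= K * (maxn (N n) (T0 n))%:R] (1 - delta / 3).
  by near: n; exact: hE.
have pC : inner_prob_ge P
    [set w | C - C / 2 <= eigval ((maxn (N n) (T0 n))%:R^-1 *: ((E n w)^T *m E n w))
                            (Num.truncn (c * (minn (N n) (T0 n))%:R))] (1 - delta / 3).
  by near: n; exact: hlow.
have := inner_prob_geI (inner_prob_geI pF pE) pC.
rewrite (_ : delta / 3 + delta / 3 + delta / 3 = delta); last by field.
apply: inner_prob_geS => w /= [[wF wE] wC].
apply: (argmax_ratio_factor (k := Num.truncn (c * (minn (N n) (T0 n))%:R))
  (mu := mu) (B := B) (M := M) (m := c1 * a / 2) (K := K) (C := C / 2)) => //.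
- by rewrite hr0 ltnW.
(* The subtraction in [maxk] is truncated; [r0max] makes rmax positive, so no truncation occurs and
   rmax + r0 + 1 <= k follows. *)
- by rewrite kN andbT; clear -r0max maxk; lia.
- by rewrite divr_gt0 ?mulr_gt0.
- move=> u; rewrite -quad_gram -quadZ.
  have := @quad_perturb _ _ ((T0 n)%:R^-1 *: ((F n w)^T *m F n w)) SigF mu u _ hA1c.
  rewrite linearZ /= gram_sym => /(_ erefl).
  move: wF; rewrite subr0 => /(le_trans (ler_norm _)) wF /(_ wF).
  by rewrite (_ : eigval SigF r0 - mu = mu)// muE; ring.
- by move=> u; apply: loadings_ge; rewrite ?mulr_gt0.
- exact: le_trans (ler_norm _) wE.
- by apply: le_trans wC; lra.
- apply: le_trans la _; apply: le_trans aN; rewrite -[leRHS]mul1r.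
  by rewrite ler_pM2r.
- have h := ler_wpM2l (ltW K0) la; apply: le_trans h _.
  have := ler_wpM2r (ltW a0) etaK; rewrite /kappa; lra.
- rewrite (_ : mu * (c1 * a / 2) / 4 = kappa * a); last by rewrite /kappa; field.
  rewrite exprMn; apply: le_lt_trans (ler_wpM2l (ltW (mulr_gt0 D0 K0)) hl) _.
  by rewrite mulrA ltr_pM2r ?exprn_gt0.
- rewrite (_ : mu * (c1 * a / 2) / 4 = kappa * a); last by rewrite /kappa; field.
  rewrite [ltRHS]mulrAC; apply: le_lt_trans (ler_wpM2l (sqr_ge0 K) la) _.
  by rewrite mulrA ltr_pM2r.
Unshelve. all: by end_near. Qed.
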